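(* Let $\mathcal{M}=\{A,B,C,D\}$ be a minimal continuous-time system with passive transfer function, and let $\gamma$, $\gamma_\xi$, $\gamma_\omega$, $\Phi_\xi$, and the HEC-based algorithm for computing $\Xi$ be as defined in the context. Let $(\tilde\xi,\tilde\omega)$ be any pseudoroot of the root-min problem $\min_{\omega}\gamma(\xi,\omega)=0$ computed by HEC within this algorithm. If (i) after some point, HEC only generates iterates that lie on a single open continuous path $\omega_{\mathrm p}:\mathbb{R}\to\mathbb{R}$ of stationary points of $\gamma_\xi$ as $\xi$ varies, (ii) $\tilde\omega=\omega_{\mathrm p}(\tilde\xi)$ is a local minimizer of $\gamma_{\tilde\xi}$, (iii) $\gamma_{\tilde\omega}'(\tilde\xi)\neq 0$, (iv) $\gamma$ is twice continuously differentiable at $(\tilde\xi,\tilde\omega)$, and (v) $\omega_{\mathrm p}$ is twice continuously differentiable at $\tilde\xi$, all hold, then the algorithm converges Q-quadratically to the pseudoroot $(\tilde\xi,\tilde\omega)$, i.e., the sequence $\{\xi_k\}$ generated by the HEC run computing it converges Q-quadratically to $\tilde\xi$. Furthermore, if (i)–(iii) hold, $\gamma(\tilde\xi,\tilde\omega)$ corresponds to a simple eigenvalue of $\Phi_{\tilde\xi}(\mathbf{i}\tilde\omega)$, and $\gamma_{\tilde\xi}''(\tilde\omega)\neq 0$, then (iv) and (v) are automatically satisfied.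
   Context: Setting. $A\in\mathbb{C}^{n\times n}$, $B\in\mathbb{C}^{n\times m}$, $C\in\mathbb{C}^{m\times n}$, $D\in\mathbb{C}^{m\times m}$; $\mathcal{M}$ is minimal, i.e., $(A,B)$ is controllable and $(A,C)$ is observable. The transfer function is $\mathcal{T}(s)=C(sI_n-A)^{-1}B+D$. With $\mathcal{T}^{\mathsf H}(s):=B^{\mathsf H}(sI_n-A^{\mathsf H})^{-1}C^{\mathsf H}+D^{\mathsf H}$ and $\Phi(s)=\mathcal{T}^{\mathsf H}(-s)+\mathcal{T}(s)$, $\mathcal{T}$ is passive if $\Phi(\mathbf{i}\omega)\succeq0$ for all $\omega\in\mathbb{R}\cup\{\infty\}$ and the spectral abscissa $\alpha(A)\le 0$, with any imaginary-axis eigenvalues of $A$ being semi-simple with Hermitian positive semidefinite transfer function residue; it is strictly passive if $\Phi(\mathbf{i}\omega)\succ0$ for all $\omega\in\mathbb{R}\cup\{\infty\}$ and $\alpha(A)<0$. For $\xi\in\mathbb{R}$, let $A_\xi=A+\frac{\xi}{2}I_n$, $D_\xi=D-\frac{\xi}{2}I_m$, $\mathcal{T}_\xi(s)=C(sI_n-A_\xi)^{-1}B+D_\xi$, and $\Phi_\xi(s)=\mathcal{T}_\xi^{\mathsf H}(-s)+\mathcal{T}_\xi(s)$, so that $\Phi_\xi(\mathbf{i}\omega)=[\mathcal{T}_\xi(\mathbf{i}\omega)]^{\mathsf H}+\mathcal{T}_\xi(\mathbf{i}\omega)$. Let $\Xi=\sup\{\xi\in\mathbb{R}:\mathcal{T}_\xi\text{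 is strictly passive}\}$. Define $\gamma(\xi,\omega)=\lambda_{\min}(\Phi_\xi(\mathbf{i}\omega))$, $\gamma_\xi(\omega)=\gamma(\xi,\omega)$ for fixed $\xi$, and $\gamma_\omega(\xi)=\gamma(\xi,\omega)$ for fixed $\omega$. Let $$\Xi_{\mathrm{lb}}=\lambda_{\min}\begin{bmatrix}-A^{\mathsf H}-A & C^{\mathsf H}-B\\ C-B^{\mathsf H} & D^{\mathsf H}+D\end{bmatrix},\qquad \Xi_{\mathrm{ub}}=\min\{-2\alpha(A),\lambda_{\min}(D^{\mathsf H}+D)\},$$ which satisfy $\Xi_{\mathrm{lb}}\le\Xi\le\Xi_{\mathrm{ub}}$. Root-min problem: find $\xi\in[\Xi_{\mathrm{lb}},\Xi_{\mathrm{ub}}]$ with $f(\xi)=\min_{\omega}\gamma_\xi(\omega)=0$, where $\omega$ may be taken to range over a compact subset $\mathcal{D}_2$ of $\mathbb{R}$. A pair $(\tilde\xi,\tilde\omega)$ is a pseudoroot if $\gamma(\tilde\xi,\tilde\omega)=0$ and $\tilde\omega$ is a stationary point of $\gamma_{\tilde\xi}$ (zero derivative). HEC (root-min form). Given $\xi_0\in[\Xi_{\mathrm{lb}},\Xi_{\mathrm{ub}})$ and $\omega_0$ with $\gamma(\xi_0,\omega_0)<0\le f(\Xi_{\mathrm{lb}})$, for $k=0,1,2,\dots$: (1) contraction: compute a root $\hat\xi_k\in[\Xi_{\mathrm{lb}},\xi_k]$ of $\gamma_{\omega_k}$; (2) if $\omega_k$ is a stationary point of $\gamma_{\hat\xi_k}$,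 return $(\hat\xi_k,\omega_k)$; (3) expansion: compute a stationary point $\omega_{k+1}$ of $\gamma_{\hat\xi_k}$ with $\gamma_{\hat\xi_k}(\omega_{k+1})<\gamma_{\hat\xi_k}(\omega_k)$ by a monotonic optimization solver started at $\omega_k$; (4) set $\xi_{k+1}=\hat\xi_k$. The root-finding subroutine (bracketing) and the optimization subroutine (monotonic) are deterministic and converge exactly. The computed pseudoroot $(\tilde\xi,\tilde\omega)$ is the returned pair or, if HEC does not terminate, $\tilde\xi=\lim\xi_k$ with $\tilde\omega$ a cluster point of $\{\omega_k\}$. ''Iterates lie on the path $\omega_{\mathrm p}$'' means $\omega_k=\omega_{\mathrm p}(\xi_k)$. HEC-based algorithm for $\Xi$ (Algorithm 4.1). Given a tolerance $\tau\in(0,1)$ and $\omega_0\in\mathbb{R}$, set $\xi=\Xi_{\mathrm{ub}}-\tau|\Xi_{\mathrm{ub}}|$ and stop if $\xi\le\Xi_{\mathrm{lb}}$. Repeat: if $\gamma_\xi(\omega_0)<0$ is not already known (it is tested for the given $\omega_0$ at the first pass only), compute all real zeros of $\gamma_\xi$ and replace $\omega_0$ by the midpoint of an open interval between two zeros on which $\gamma_\xi<0$, or stop and return $\xi$ if no such interval exists; then run HEC from $(\xi_0,\omega_0)$ with $\xi_0=\xi$ to obtain a pseudoroot $(\tilde\xi,\tilde\omega)$ with $\Xi\le\tilde\xi<\xi$; then set $\xi=\tilde\xi-\tau|\tilde\xi|$ and continue. Q-quadratic convergence of $\{\xi_k\}$ to $\tilde\xi$ means: $\xi_k\to\tilde\xi$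 and there is $M>0$ with $|\xi_{k+1}-\tilde\xi|\le M|\xi_k-\tilde\xi|^2$ for all sufficiently large $k$. ''Twice continuously differentiable at a point'' means in a neighborhood of the point. *)

(* Defs.v *)
From HB Require Import structures.
From mathcomp Require Export all_boot all_order all_algebra.
From mathcomp Require Export complex.
From mathcomp Require Export all_classical all_reals all_analysis.
Set Implicit Arguments.
Unset Strict Implicit.
Unset Printing Implicit Defensive.
Export Order.TTheory GRing.Theory Num.Theory numFieldNormedType.Exports.
Local Open Scope classical_set_scope.
Local Open Scope ring_scope.
Local Open Scope complex_scope.
Local Open Scope sesquilinear_scope.

Section Hermitian.
Variable R : realType.

(* An infimum in R, which is the minimum of a finite nonempty set whenever
   M is Hermitian of positive size. *)
Definition lambda_min k (M : 'M[R[i]]_k) : R :=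
  inf [set r : R | eigenvalue M r%:C].

(* On R[i], 0 <= z says that z is real and nonnegative. *)
Definition psd k (M : 'M[R[i]]_k) : Prop :=
  M \is hermsymmx /\ forall v : 'cV[R[i]]_k, 0 <= (v ^t* *m M *m v) 0 0.

Definition spectral_abscissa k (A : 'M[R[i]]_k) : R :=
  sup [set complex.Re l | l in [set l : R[i] | eigenvalue A l]].

Definition semisimple_eigenvalue k (A : 'M[R[i]]_k) (l : R[i]) : Prop :=
  eigenvalue A l /\ \rank (eigenspace A l) = mup l (char_poly A).

Definition simple_eigenvalue k (A : 'M[R[i]]_k) (l : R[i]) : Prop :=
  mup l (char_poly A) = 1%N.

End Hermitian.

Record lti (R : realType) (n m : nat) := Lti {
  stA : 'M[R[i]]_n ;
  stB : 'M[R[i]]_(n, m) ;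
  stC : 'M[R[i]]_(m, n) ;
  stD : 'M[R[i]]_m }.

Section Systems.
Variables (R : realType) (n m : nat).
Implicit Type M : lti R n m.

Definition controllable M : Prop :=
  \rank (\mxrow_(k < n) (stA M ^+ k *m stB M)) = n.

Definition observable M : Prop :=
  \rank (\mxcol_(k < n) (stC M *m stA M ^+ k)) = n.

Definition minimal M : Prop := controllable M /\ observable M.

(* invmx returns its argument on singular matrices: these formulas are
   meaningful only when s is not an eigenvalue of A (resp. of A^H). *)
Definition transfer M (s : R[i]) : 'M[R[i]]_m :=
  stC M *m invmx (s%:M - stA M) *m stB M + stD M.

Definition transferH M (s : R[i]) : 'M[R[i]]_m :=
  (stB M) ^t* *m invmx (s%:M - (stA M) ^t* ) *m (stC M) ^t* + (stD M) ^t*.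

Definition Phi M (s : R[i]) : 'M[R[i]]_m := transferH M (- s) + transfer M s.

Definition imag (w : R) : R[i] := 0 +i* w.

(* The residue of the transfer function at a simple pole p. *)
Definition simple_pole_residue M (p : R[i]) (K : 'M[R[i]^o]_m) : Prop :=
  (fun s : R[i]^o => (s - p) *: (transfer M s : 'M[R[i]^o]_m))
    @ (p : R[i]^o)^' --> K.

(* Phi (i oo) is D^H + D; at finite frequencies, the poles of the transfer
   function are covered by the residue condition. *)
Definition passive M : Prop :=
  [/\ forall w : R, ~~ eigenvalue (stA M) (imag w) -> psd (Phi M (imag w)),
      psd ((stD M) ^t* + stD M),
      spectral_abscissa (stA M) <= 0
    & forall w : R, eigenvalue (stA M) (imag w) ->
        semisimple_eigenvalue (stA M) (imag w) /\
        exists2 K : 'M[R[i]]_m, simple_pole_residue M (imag w) K & psd K].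

Definition shift M (xi : R) : lti R n m :=
  Lti (stA M + ((xi / 2)%:C)%:M) (stB M) (stC M) (stD M - ((xi / 2)%:C)%:M).

(* For xi < Xi_ub, the shifted state matrix has its spectrum in the open left
   half plane, so Phi is evaluated away from its poles. *)
Definition gamma M (xi w : R) : R := lambda_min (Phi (shift M xi) (imag w)).

Definition Xi_lb M : R :=
  lambda_min (block_mx (- (stA M) ^t* - stA M) ((stC M) ^t* - stB M)
                       (stC M - (stB M) ^t*)   ((stD M) ^t* + stD M)).

Definition Xi_ub M : R :=
  Num.min (- 2 * spectral_abscissa (stA M))
          (lambda_min ((stD M) ^t* + stD M)).

(* The objective min_w gamma_xi(w) of the root-min problem, over all w. *)
Definition min_gamma M (xi : R) : R := inf (range (gamma M xi)).

Definition stationary (f : R -> R) (x : R) : Prop := is_derive x (1 : R) f 0.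

Definition pseudoroot M (xi w : R) : Prop :=
  gamma M xi w = 0 /\ stationary (gamma M xi) w.

(* The admissible starting points of the HEC iteration. *)
Definition hec_input M (xi w : R) : Prop :=
  Xi_lb M <= xi < Xi_ub M /\ gamma M xi w < 0 <= min_gamma M (Xi_lb M).

(* Deterministic subroutines, both taking xi and w.  [root xi w] is the root
   in [Xi_lb, xi] of gamma_w; [opt xi w] is the stationary point of gamma_xi
   computed from the starting point w. *)
Record exact_subroutines M (root opt : R -> R -> R) : Prop := {
  root_exact : forall xi w : R, hec_input M xi w ->
    Xi_lb M <= root xi w <= xi /\ gamma M (root xi w) w = 0 ;
  opt_exact : forall xi w : R, Xi_lb M <= xi < Xi_ub M -> gamma M xi w = 0 ->
    ~ stationary (gamma M xi) w ->
    stationary (gamma M xi) (opt xi w) /\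
    gamma M xi (opt xi w) < gamma M xi w }.

Variant hec_state := Running of R & R | Returned of R & R.

Definition is_running (s : hec_state) : bool :=
  if s is Running _ _ then true else false.

Definition state_xi (s : hec_state) : R :=
  match s with Running x _ => x | Returned x _ => x end.

Definition state_w (s : hec_state) : R :=
  match s with Running _ w => w | Returned _ w => w end.

Definition hec_step M (root opt : R -> R -> R) (s : hec_state) : hec_state :=
  match s with
  | Running xi w =>
      let xih := root xi w in
      if `[< stationary (gamma M xih) w >] then Returned xih w
      else Running xih (opt xih w)
  | Returned xi w => Returned xi w
  end.

Definition hec M (root opt : R -> R -> R) (xi0 w0 : R) (k : nat) : hec_state :=
  iter k (hec_step M root opt) (Running xi0 w0).

(* The iterates (xi_k, w_k); after termination they stay at the returned
   pair. *)
Definition hec_xi M root opt (xi0 w0 : R) : R^nat :=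
  fun k => state_xi (hec M root opt xi0 w0 k).

Definition hec_w M root opt (xi0 w0 : R) : R^nat :=
  fun k => state_w (hec M root opt xi0 w0 k).

Definition hec_computes M root opt (xi0 w0 xit wt : R) : Prop :=
  hec_input M xi0 w0 /\
  ((exists k, hec M root opt xi0 w0 k = Returned xit wt) \/
   [/\ forall k, is_running (hec M root opt xi0 w0 k),
       hec_xi M root opt xi0 w0 @ \oo --> xit
     & cluster (hec_w M root opt xi0 w0 @ \oo) wt]).

Definition negative_midpoint M (xi w : R) : Prop :=
  exists a b : R, [/\ a < b, gamma M xi a = 0, gamma M xi b = 0,
    forall x : R, a < x < b -> gamma M xi x < 0 & w = (a + b) / 2].

(* [hec_call M tau w0 root opt xi w]: the algorithm with tolerance tau and
   initial frequency w0 may run HEC from (xi, w).  The algorithm stops exactly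
   when no constructor applies. *)
Inductive hec_call M (tau w0 : R) (root opt : R -> R -> R) : R -> R -> Prop :=
| call_given (xi := Xi_ub M - tau * `|Xi_ub M|) :
    Xi_lb M < xi -> gamma M xi w0 < 0 -> hec_call M tau w0 root opt xi w0
| call_first (xi := Xi_ub M - tau * `|Xi_ub M|) (w : R) :
    Xi_lb M < xi -> ~ gamma M xi w0 < 0 -> negative_midpoint M xi w ->
    hec_call M tau w0 root opt xi w
| call_next (xi w xit wt w' : R) :
    hec_call M tau w0 root opt xi w ->
    hec_computes M root opt xi w xit wt ->
    negative_midpoint M (xit - tau * `|xit|) w' ->
    hec_call M tau w0 root opt (xit - tau * `|xit|) w'.

End Systems.

Section Analysis.
Variable R : realType.

Definition C2_at (V : normedModType R) (f : V -> R) (x : V) : Prop :=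
  \forall y \near x,
    [/\ differentiable f y,
        forall u : V, differentiable ('D_u f) y
      & forall u v : V, {for y, continuous ('D_v ('D_u f))}].

Definition q_quadratic (u : R^nat) (l : R) : Prop :=
  u @ \oo --> l /\
  exists2 c : R, 0 < c &
    \forall k \near \oo, `|u k.+1 - l| <= c * `|u k - l| ^+ 2.

(* A continuous path of stationary points of gamma_xi over an open interval of
   values of xi, possibly all of R. *)
Definition stationary_path n m (M : lti R n m) (I : set R) (wp : R -> R) :
    Prop :=
  [/\ open I, is_interval I, {in I, continuous wp}
    & forall xi, I xi -> stationary (gamma M xi) (wp xi)].

End Analysis.

(* Main.v *)
From HB Require Import structures.
Require Import Defs.
From mathcomp Require Import perm ring lra.
Set Implicit Arguments.
Unset Strict Implicit.
Unset Printing Implicit Defensive.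
Local Open Scope classical_set_scope.
Local Open Scope ring_scope.
Local Open Scope complex_scope.
Local Open Scope sesquilinear_scope.

(** The objective gamma(xi, w) is the least eigenvalue of a Hermitian matrix
    whose entries are rational in (xi, w), without poles for xi < Xi_ub, and
    every value of xi met by the iteration lies below Xi_ub.

    Quadratic convergence.  While the iteration runs,
    gamma(xi_{k+1}, w_k) = 0 with w_k = wp(xi_k).  Split
    gamma(xi_{k+1}, w_k) - gamma(xit, wt) into a variation in xi at the
    frequency w_k and a variation in w at the level xit.  By the mean value
    theorem the first is at least a positive multiple of |xi_{k+1} - xit|,
    because the derivative of gamma in xi is continuous and nonzero at
    (xit, wt).  The second is O(|w_k - wt|^2), because the derivative of gamma
    in w is differentiable and vanishes at (xit, wt); and
    |w_k - wt| = |wp(xi_k) - wp(xit)| = O(|xi_k - xit|).  The two variations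
    cancel, so |xi_{k+1} - xit| = O(|xi_k - xit|^2).  This is
    [q_quadratic_root_on_path].

    Automatic smoothness.  Both gamma and the path wp are implicit functions.
    By Weyl's inequality gamma is continuous; it solves det(l I - Phi) = 0,
    whose derivative in l is nonzero at a simple eigenvalue, the spectrum being
    real ([gamma_smooth]).  Then wp, which is continuous, solves
    (d/dw) gamma = 0, whose derivative in w is nonzero by assumption
    ([stationary_path_smooth]).  As the functions are given and continuous, only
    the regularity half of the implicit function theorem is required: a
    continuous solution of a C^k equation with nonzero derivative in the
    unknown is C^k.  Differentiability follows from a first-order expansion of
    the equation, and the formula for the derivative raises the regularity one
    order at a time ([Ck_implicit]).  Since wp is defined by a derivative of
    gamma, three derivatives of gamma are used. *)

(** * Functions with continuous iterated directional derivatives *)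

Section DifferentiabilityByEstimate.
Variables (R : realType) (V : normedModType R).
Implicit Types (f g : V -> R) (x : V) (U : set V).

Lemma differentiable_estimate f x (L : {linear V -> R}) :
    continuous L ->
    (forall e : R, 0 < e ->
      \forall h \near (0 : V), `|f (h + x) - f x - L h| <= e * `|h|) ->
  differentiable f x.
Proof.
move=> Lcont Lf.
have Lo : f \o pseudometric_normed_Zmodule.shift x =
    cst (f x) + (L : V -> R) +o_ 0 id.
  apply/eqaddoP => e e0; near=> h.
  rewrite /= opprD addrA; near: h; exact: Lf.
apply/diff_locallyP; rewrite (diff_unique Lcont Lo); split => //.
Unshelve. all: by end_near. Qed.

Lemma diff_estimate f x : differentiable f x -> forall e : R, 0 < e ->
  \forall h \near (0 : V), `|f (h + x) - f x - 'd f x h| <= e * `|h|.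
Proof.
move=> /diff_locally/eqaddoP fo e e0; have {fo} := fo _ e0.
by apply: filterS => h /=; rewrite opprD addrA.
Qed.

Lemma near_eq_differentiable f g x :
  (\near x, f x = g x) -> differentiable f x -> differentiable g x.
Proof.
move=> fg df; have fgx := nbhs_singleton fg.
apply: (@differentiable_estimate g x ('d f x)).
  exact: diff_continuous.
move=> e e0; have shiftx : (fun h : V => h + x) @ (0 : V) --> x.
  by rewrite -[X in _ --> X]add0r; apply: cvgD; [exact: cvg_id|exact: cvg_cst].
near=> h.
have <- : f (h + x) = g (h + x) by near: h; exact: (shiftx _ fg).
rewrite -fgx; near: h; exact: diff_estimate.
Unshelve. all: by end_near. Qed.

End DifferentiabilityByEstimate.

Section Ck.
Variable (R : realType).

(** The condition is imposed on a whole set, open in every use, and not at a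
    point, so that inductions on the order keep the same domain. *)
Fixpoint Ck (V : normedModType R) (k : nat) (U : set V) (f : V -> R) : Prop :=
  if k is k'.+1 then
    (forall x, U x -> differentiable f x) /\ forall u, Ck k' U ('D_u f)
  else forall x, U x -> {for x, continuous f}.

Section Closure.
Variables (V : normedModType R) (U : set V).
Hypothesis openU : open U.
Implicit Types (f g : V -> R) (x : V).

Let nearU x : U x -> \forall y \near x, U y.
Proof. by move=> Ux; apply: open_nbhs_nbhs; split. Qed.

Lemma Ck_eq k f g : (forall x, U x -> f x = g x) -> Ck k U f -> Ck k U g.
Proof.
elim: k f g => [|k IHk] f g fg /=.
  move=> fc x Ux; rewrite /prop_for /continuous_at -(fg _ Ux).
  apply: cvg_trans (fc x Ux); apply: near_eq_cvg.
  by near=> y; apply: fg; near: y; exact: nearU.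
have fgn x : U x -> \near x, f x = g x.
  by move=> Ux; near=> y; apply: fg; near: y; exact: nearU.
move=> [df Df]; split=> [x Ux|u].
  by apply: near_eq_differentiable (df x Ux); exact: fgn.
apply: IHk (Df u) => x Ux; apply: near_eq_derive; exact: fgn.
Unshelve. all: by end_near. Qed.

Lemma CkS k f : Ck k.+1 U f -> Ck k U f.
Proof.
elim: k f => [|k IHk] f [df Df].
  by move=> x /df; exact: differentiable_continuous.
by split=> // u; apply: IHk; exact: Df.
Qed.

Lemma Ck_continuous k f x : Ck k U f -> U x -> {for x, continuous f}.
Proof. by elim: k => [|k IHk]; [exact|move/CkS]. Qed.

Lemma Ck_cst k (c : R) : Ck k U (cst c).
Proof.
elim: k c => [|k IHk] c /=; first by move=> x _; exact: cst_continuous.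
split=> [x _|u]; first exact: differentiable_cst.
by apply: Ck_eq (IHk 0) => x _; rewrite derive_cst.
Qed.

Lemma Ck_linear k (L : {linear V -> R}) : continuous L -> Ck k U L.
Proof.
move=> Lc; case: k => [x _|k] /=; first exact: Lc.
split=> [x _|u]; first exact: linear_differentiable.
apply: Ck_eq (Ck_cst k (L u)) => x _.
by rewrite deriveE ?diff_lin//; exact: linear_differentiable.
Qed.

Lemma CkD k f g : Ck k U f -> Ck k U g -> Ck k U (fun x => f x + g x).
Proof.
elim: k f g => [|k IHk] f g /=.
  by move=> fc gc x Ux; apply: cvgD; [exact: fc|exact: gc].
move=> [df Df] [dg Dg]; split=> [x Ux|u].
  by apply: differentiableD; [exact: df|exact: dg].
apply: Ck_eq (IHk _ _ (Df u) (Dg u)) => x Ux.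
by rewrite [RHS]deriveD//; apply: diff_derivable; [exact: df|exact: dg].
Qed.

Lemma CkM k f g : Ck k U f -> Ck k U g -> Ck k U (fun x => f x * g x).
Proof.
elim: k f g => [|k IHk] f g /=.
  by move=> fc gc x Ux; apply: cvgM; [exact: fc|exact: gc].
move=> [df Df] [dg Dg]; split=> [x Ux|u].
  by apply: differentiableM; [exact: df|exact: dg].
have fk : Ck k U f by apply: CkS.
have gk : Ck k U g by apply: CkS.
apply: Ck_eq (CkD (IHk _ _ fk (Dg u)) (IHk _ _ gk (Df u))) => x Ux.
by rewrite [RHS]deriveM//; apply: diff_derivable; [exact: df|exact: dg].
Qed.

Lemma CkN k f : Ck k U f -> Ck k U (fun x => - f x).
Proof.
move=> fk; apply: Ck_eq (CkM (Ck_cst k (-1)) fk) => x _.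
by rewrite mulN1r.
Qed.

Lemma CkV k f : (forall x, U x -> f x != 0) -> Ck k U f ->
  Ck k U (fun x => (f x)^-1).
Proof.
move=> f0; elim: k => [|k IHk] /=.
  by move=> fc x Ux; apply: cvgV; [exact: f0|exact: fc].
move=> [df Df]; split=> [x Ux|u].
  by apply: differentiableV; [exact: df|exact: f0].
have Vk : Ck k U (fun x => (f x)^-1) by apply: IHk; apply: CkS.
apply: Ck_eq (CkN (CkM (CkM Vk Vk) (Df u))) => x Ux.
rewrite [RHS](@deriveV _ _ f x u (f0 _ Ux)); last exact/diff_derivable/df.
by rewrite -invfM expr2 /GRing.scale/= mulNr.
Qed.

End Closure.

End Ck.

(** * Regularity of implicit functions *)

Section Implicit.
Variables (R : realType) (V : normedModType R).
Implicit Types (G F : V * R -> R) (h : V -> R).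

Lemma continuous_graph h x : {for x, continuous h} ->
  (fun y => (y, h y)) @ x --> (x, h x).
Proof. by move=> hc; exact: (cvg_pair cvg_id hc). Qed.

Lemma diff_graph G h x (u : V) :
  differentiable G (x, h x) -> differentiable h x ->
  differentiable (fun y => G (y, h y)) x /\
  'D_u (fun y => G (y, h y)) x =
    'D_(u, 0) G (x, h x) + 'D_u h x * 'D_(0, 1) G (x, h x).
Proof.
move=> dG dh.
have dgr : differentiable (fun y => (y, h y)) x by exact: differentiable_pair.
have dGgr : differentiable (G \o (fun y => (y, h y))) x
  by exact: differentiable_comp.
split=> //; rewrite (deriveE u dGgr) diff_comp// diff_pair//= diff_val.
rewrite !deriveE//.
have -> : (u, 'd h x u) = (u, 0) + 'd h x u *: (0, 1) :> V * R.
  by congr pair; rewrite /= ?scaler0 ?addr0 ?add0r// /GRing.scale/= mulr1.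
by rewrite linearD linearZ.
Qed.

Lemma Ck_graph k (U : set V) (W : set (V * R)) G h : open U ->
  (forall x, U x -> W (x, h x)) -> Ck k W G -> Ck k U h ->
  Ck k U (fun x => G (x, h x)).
Proof.
move=> oU UW; elim: k G h UW => [|k IHk] G h UW /=.
  move=> Gc hc x Ux.
  have := Gc _ (UW _ Ux).
  rewrite /prop_for /continuous_at => Gcx.
  have := continuous_graph (hc _ Ux).
  move=> /cvg_comp; apply. exact: Gcx.
move=> [dG DG] [dh Dh]; split=> [x Ux|u].
  by have [] := diff_graph 0 (dG _ (UW _ Ux)) (dh _ Ux).
have hk : Ck k U h by apply: CkS.
apply: Ck_eq (CkD oU (IHk _ _ UW (DG (u, 0)) hk)
                     (CkM oU (Dh u) (IHk _ _ UW (DG (0, 1)) hk))) => // x Ux.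
by have [_ ->] := diff_graph u (dG _ (UW _ Ux)) (dh _ Ux).
Qed.

(** Expanding F(y, h y) = 0 to first order at x and dividing by the derivative
    of F in its last variable gives h (x + v) - h x = L v up to a small multiple
    of |v| + |h (x + v) - h x|; the continuity of h allows the second term to be
    absorbed into the left-hand side. *)
Lemma implicit_differentiable F h x :
  differentiable F (x, h x) -> {for x, continuous h} ->
  (\near x, F (x, h x) = 0) -> 'D_(0, 1) F (x, h x) != 0 ->
  differentiable h x.
Proof.
set p := (x, h x) => dF hc F0; rewrite deriveE//; set a := 'd F p _ => a0.
pose L v := - a^-1 * 'd F p (v, 0) : R.
have Llin : linear L.
  move=> c u v; rewrite /L.
  have -> : (c *: u + v, 0) = c *: (u, 0) + (v, 0) :> V * R.
    by congr pair; rewrite /= scaler0 addr0.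
  by rewrite linearD linearZ mulrDr -[LHS]/(_ * (c * _) + _) mulrCA.
pose LL : {linear V -> R} := HB.pack_for {linear V -> R} L
  (GRing.isLinear.Build _ _ _ _ _ Llin).
have Lcont : continuous LL.
  move=> v; apply: cvgM; first exact: cvg_cst.
  have dFc := diff_continuous dF.
  have v0 : (fun v : V => (v, 0 : R)) @ v --> (v, 0 : R).
    exact: (cvg_pair cvg_id (cvg_cst _)).
  exact: (cvg_comp _ _ v0 (dFc (v, 0))).
have FE (v : V) (t : R) : 'd F p (v, t) = a * (t - L v).
  have -> : (v, t) = (v, 0) + t *: (0, 1) :> V * R.
    by congr pair; rewrite /= ?scaler0 ?addr0 ?add0r// /GRing.scale/= mulr1.
  rewrite linearD linearZ -[LHS]/(_ + t * a) /L mulrBr mulrA mulrN divff//.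
  by rewrite mulN1r opprK addrC mulrC.
apply: (@differentiable_estimate _ _ _ _ LL) => // e e0.
have /linear_lipschitz[K K0 LK] := Lcont.
(* eta <= 1/2 absorbs the increment of h; eta (2 (1 + K)) <= e meets the goal *)
pose eta := Num.min (1 / 2) (e / (2 * (1 + K))).
have K1 : 0 < 1 + K by rewrite addr_gt0.
have eta0 : 0 < eta by rewrite lt_min !divr_gt0// mulr_gt0.
have eta1 : eta <= 1 / 2 by rewrite ge_min lexx.
have eta2 : eta * (2 * (1 + K)) <= e.
  by rewrite -ler_pdivlMr ?mulr_gt0// ge_min lexx orbT.
have shiftx : (fun v : V => v + x) @ (0 : V) --> x.
  by rewrite -[X in _ --> X]add0r; apply: cvgD; [exact: cvg_id|exact: cvg_cst].
have inc0 : (fun v : V => (v, h (v + x) - h x)) @ (0 : V) --> ((0, 0) : V * R).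
  have ht0 : (fun v : V => h (v + x) - h x) @ (0 : V) --> (0 : R).
    rewrite -(subrr (h x)); apply: cvgB; last exact: cvg_cst.
    exact: (cvg_comp _ _ shiftx hc).
  exact: (cvg_pair cvg_id ht0).
have ae0 : 0 < `|a| * eta by rewrite mulr_gt0 ?normr_gt0.
have dest := diff_estimate dF ae0.
have inc00 : \forall v \near (0 : V),
    `|F ((v, h (v + x) - h x) + p) - F p - 'd F p (v, h (v + x) - h x)|
      <= `|a| * eta * `|(v, h (v + x) - h x)|.
  exact: (inc0 _ dest).
near=> v.
have F0p : F p = 0 by exact: nbhs_singleton F0.
have F0v : F (v + x, h (v + x)) = 0 by near: v; exact: (shiftx _ F0).
have estF : `|F ((v, h (v + x) - h x) + p) - F p - 'd F p (v, h (v + x) - h x)|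
    <= `|a| * eta * `|(v, h (v + x) - h x)| by near: v; exact: inc00.
set t := h (v + x) - h x in estF *.
have est : `|t - L v| <= eta * `|(v, t)|.
  have vtp : (v, t) + p = (v + x, h (v + x)) by congr pair; rewrite /= subrK.
  move: estF; rewrite vtp.
  rewrite F0p F0v subrr sub0r normrN FE normrM -mulrA ler_pM2l//.
  by rewrite normr_gt0.
have tL : `|t| <= `|t - L v| + K * `|v|.
  rewrite -{1}(subrK (L v) t) (le_trans (ler_normD _ _))// lerD2l//.
have vt : `|(v, t)| <= `|v| + `|t|.
  by rewrite prod_normE/= ge_max lerDl lerDr !normr_ge0.
rewrite -[LL v]/(L v).
have v0 := normr_ge0 v.
have := normr_ge0 (t - L v); have := normr_ge0 t.
move: (`|t - L v|) (`|t|) (`|v|) (`|(v, t)|) est tL vt v0.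
move=> T s r q est tL vt r0 s0 T0.
have e1 : eta * q <= eta * (r + T + K * r) by rewrite ler_pM2l//; lra.
have e2 : eta * T <= 1 / 2 * T by rewrite ler_wpM2r.
have e3 : eta * (2 * (1 + K)) * r <= e * r by rewrite ler_wpM2r.
lra.
Unshelve. all: by end_near. Qed.

(** Bootstrap: the derivative of h is a quotient of derivatives of F along the
    graph of h, so it has the regularity already known for h, and h has one
    order more. *)
Lemma Ck_implicit k (U : set V) (W : set (V * R)) F h : open U ->
  (forall x, U x -> W (x, h x)) -> Ck k.+1 W F ->
  (forall x, U x -> {for x, continuous h}) ->
  (forall x, U x -> F (x, h x) = 0) ->
  (forall x, U x -> 'D_(0, 1) F (x, h x) != 0) ->
  Ck k.+1 U h.
Proof.
move=> oU UW Fk hc F0 DF0.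
have dh x : U x -> differentiable h x.
  move=> Ux; apply: implicit_differentiable (hc x Ux) _ (DF0 x Ux).
    by case: Fk => dF _; exact: dF (UW _ Ux).
  have : \forall y \near x, U y by apply: open_nbhs_nbhs.
  by apply: filterS => y; exact: F0.
have Dh k' u : Ck k'.+1 W F -> Ck k' U h -> Ck k' U ('D_u h).
  move=> [dF DF] hk.
  have gk w := Ck_graph oU UW (DF w) hk.
  have quot := CkN oU (CkM oU (gk (u, 0)) (CkV oU DF0 (gk (0, 1)))).
  apply: Ck_eq quot => // x Ux.
  have [_ chain] := diff_graph u (dF _ (UW _ Ux)) (dh _ Ux).
  have : 'D_u (fun y => F (y, h y)) x = 0.
    rewrite -[RHS](derive_cst (0 : R) x u); apply: near_eq_derive.
    have : \forall y \near x, U y by apply: open_nbhs_nbhs.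
    by apply: filterS => y; exact: F0.
  rewrite chain => /eqP; rewrite addr_eq0 => /eqP ->.
  by rewrite mulNr opprK mulfK// DF0.
elim: k Fk => [|k IHk] Fk.
  by split=> // u; apply: Dh.
have hk : Ck k.+1 U h.
  apply: IHk; case: Fk => dF DF; split => // u.
  exact: CkS.
by split=> // u; apply: Dh.
Qed.

End Implicit.

(** * Smooth complex-valued functions and matrices *)

Section ComplexCk.
Variables (R : realType) (V : normedModType R) (U : set V) (k : nat).
Hypothesis openU : open U.
Implicit Types (f g : V -> R[i]).

(** Real and imaginary parts are treated separately because R[i] is a normed
    space over itself, whereas the variables here are real. *)
Definition CkC f :=
  Ck k U (fun x => complex.Re (f x)) /\ Ck k U (fun x => complex.Im (f x)).

Lemma CkC_eq f g : (forall x, U x -> f x = g x) -> CkC f -> CkC g.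
Proof.
by move=> fg [rf jf]; split; [apply: Ck_eq rf|apply: Ck_eq jf] => // x /fg ->.
Qed.

Lemma CkC_cst c : CkC (fun=> c).
Proof. by split; exact: Ck_cst. Qed.

Lemma CkC_real (a : V -> R) : Ck k U a -> CkC (fun x => (a x)%:C).
Proof. by move=> ak; split=> //; exact: Ck_cst. Qed.

Lemma CkCD f g : CkC f -> CkC g -> CkC (fun x => f x + g x).
Proof.
move=> [rf jf] [rg jg]; split.
- apply: (Ck_eq openU) (CkD openU rf rg) => x _ /=.
  by case: (f x) (g x) => ? ? [].
- apply: (Ck_eq openU) (CkD openU jf jg) => x _ /=.
  by case: (f x) (g x) => ? ? [].
Qed.

Lemma CkCM f g : CkC f -> CkC g -> CkC (fun x => f x * g x).
Proof.
move=> [rf jf] [rg jg]; split.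
- apply: (Ck_eq openU)
    (CkD openU (CkM openU rf rg) (CkN openU (CkM openU jf jg))) => x _ /=.
  by case: (f x) (g x) => ? ? [].
- apply: (Ck_eq openU)
    (CkD openU (CkM openU rf jg) (CkM openU jf rg)) => x _ /=.
  by case: (f x) (g x) => ? ? [].
Qed.

Lemma CkCN f : CkC f -> CkC (fun x => - f x).
Proof.
move=> fk; apply: CkC_eq (CkCM (CkC_cst (-1)) fk) => x _; exact: mulN1r.
Qed.

Lemma CkC_conj f : CkC f -> CkC (fun x => (f x)^*%R).
Proof.
move=> [rf jf]; split.
- by apply: (Ck_eq openU) rf => x _ /=; case: (f x).
- by apply: (Ck_eq openU) (CkN openU jf) => x _ /=; case: (f x).
Qed.

Lemma CkCV f : (forall x, U x -> f x != 0) -> CkC f -> CkC (fun x => (f x)^-1).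
Proof.
move=> f0 fk; have [rf jf] := fk.
pose q x := complex.Re (f x) * complex.Re (f x)
          + complex.Im (f x) * complex.Im (f x).
have qk : Ck k U q.
  exact: (CkD openU (CkM openU rf rf) (CkM openU jf jf)).
have q0 x : U x -> q x != 0.
  move=> /f0; rewrite /q; case: (f x) => a b /= ab0.
  apply: contra ab0; rewrite -!expr2 paddr_eq0 ?sqr_ge0// !sqrf_eq0.
  by move=> /andP[/eqP-> /eqP->].
apply: CkC_eq (CkCM (CkC_conj fk) (CkC_real (CkV openU q0 qk))) => x Ux.
apply: (mulfI (f0 x Ux)); rewrite divff ?f0// mulrA.
have -> : f x * (f x)^*%R = (q x)%:C.
  rewrite /q; case: (f x) => a b; apply/eqP; rewrite eq_complex /=.
  by apply/andP; split; apply/eqP; ring.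
by rewrite -rmorphM /= divff// q0.
Qed.

Lemma CkC_sum (T : Type) (s : seq T) (P : pred T) (F : T -> V -> R[i]) :
  (forall i, CkC (F i)) -> CkC (fun x => \sum_(i <- s | P i) F i x).
Proof.
move=> Fk; elim: s => [|i s IHs].
  by apply: CkC_eq (CkC_cst 0) => x _; rewrite big_nil.
have [Pi|NPi] := boolP (P i).
  by apply: CkC_eq (CkCD (Fk i) IHs) => x _; rewrite big_cons Pi.
by apply: CkC_eq IHs => x _; rewrite big_cons (negPf NPi).
Qed.

Lemma CkC_prod (T : Type) (s : seq T) (P : pred T) (F : T -> V -> R[i]) :
  (forall i, CkC (F i)) -> CkC (fun x => \prod_(i <- s | P i) F i x).
Proof.
move=> Fk; elim: s => [|i s IHs].
  by apply: CkC_eq (CkC_cst 1) => x _; rewrite big_nil.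
have [Pi|NPi] := boolP (P i).
  by apply: CkC_eq (CkCM (Fk i) IHs) => x _; rewrite big_cons Pi.
by apply: CkC_eq IHs => x _; rewrite big_cons (negPf NPi).
Qed.

Definition CkMx p q (F : V -> 'M[R[i]]_(p, q)) :=
  forall i j, CkC (fun x => F x i j).

Lemma CkMx_eq p q (F G : V -> 'M[R[i]]_(p, q)) :
  (forall x, U x -> F x = G x) -> CkMx F -> CkMx G.
Proof. by move=> FG Fk i j; apply: CkC_eq (Fk i j) => x /FG ->. Qed.

Lemma CkMx_cst p q (c : 'M[R[i]]_(p, q)) : CkMx (fun=> c).
Proof. by move=> i j; exact: CkC_cst. Qed.

Lemma CkMx_scalar p f : CkC f -> CkMx (fun x => (f x)%:M : 'M[R[i]]_p).
Proof.
move=> fk i j; have [<-|ij] := eqVneq i j.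
  by apply: CkC_eq fk => x _; rewrite mxE eqxx.
by apply: CkC_eq (CkC_cst 0) => x _; rewrite mxE (negPf ij).
Qed.

Lemma CkMxD p q (F G : V -> 'M[R[i]]_(p, q)) :
  CkMx F -> CkMx G -> CkMx (fun x => F x + G x).
Proof.
by move=> Fk Gk i j; apply: CkC_eq (CkCD (Fk i j) (Gk i j)) => x _; rewrite mxE.
Qed.

Lemma CkMxN p q (F : V -> 'M[R[i]]_(p, q)) : CkMx F -> CkMx (fun x => - F x).
Proof.
by move=> Fk i j; apply: CkC_eq (CkCN (Fk i j)) => x _; rewrite mxE.
Qed.

Lemma CkMxM p q r (F : V -> 'M[R[i]]_(p, q)) (G : V -> 'M[R[i]]_(q, r)) :
  CkMx F -> CkMx G -> CkMx (fun x => F x *m G x).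
Proof.
move=> Fk Gk i j.
have FGk l := CkCM (Fk i l) (Gk l j).
apply: CkC_eq (CkC_sum (index_enum 'I_q) predT FGk).
by move=> x _; rewrite mxE.
Qed.

Lemma CkMx_adj p q (F : V -> 'M[R[i]]_(p, q)) :
  CkMx F -> CkMx (fun x => (F x) ^t*).
Proof.
by move=> Fk i j; apply: CkC_eq (CkC_conj (Fk j i)) => x _; rewrite !mxE.
Qed.

Lemma CkC_det p (F : V -> 'M[R[i]]_p) : CkMx F -> CkC (fun x => \det (F x)).
Proof.
move=> Fk; apply: CkC_eq (CkC_sum (index_enum _) predT (fun s : {perm 'I_p} =>
  CkCM (CkC_cst ((-1) ^+ s))
       (CkC_prod (index_enum 'I_p) predT (fun i => Fk i (s i))))) => x _.
by [].
Qed.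

Lemma CkMx_inv p (F : V -> 'M[R[i]]_p) :
  (forall x, U x -> F x \in unitmx) -> CkMx F -> CkMx (fun x => invmx (F x)).
Proof.
move=> Fu Fk i j.
have det0 x : U x -> \det (F x) != 0 by move=> /Fu; rewrite unitmxE unitfE.
have minork : CkMx (fun x => row' j (col' i (F x))).
  by move=> a b; apply: CkC_eq (Fk (lift j a) (lift i b)) => x _; rewrite !mxE.
apply: CkC_eq (CkCM (CkCV det0 (CkC_det Fk))
  (CkCM (CkC_cst ((-1) ^+ (j + i))) (CkC_det minork))) => x Ux.
by rewrite /invmx Fu// !mxE.
Qed.

End ComplexCk.

(** * The least eigenvalue of a Hermitian matrix *)

Section Rayleigh.
Variable (R : realType).
Implicit Types (p : nat).

(** The squared modulus as an element of R: the norm of R[i] is R[i]-valued. *)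
Definition nsqc (z : R[i]) : R := complex.Re z ^+ 2 + complex.Im z ^+ 2.

Definition quad p (H : 'M[R[i]]_p) (v : 'rV[R[i]]_p) : R :=
  complex.Re ((v *m H *m v ^t* ) 0 0).

Definition nsq p (v : 'rV[R[i]]_p) : R := \sum_j nsqc (v 0 j).

Definition l1norm p (E : 'M[R[i]]_p) : R :=
  \sum_i \sum_j (`|complex.Re (E i j)| + `|complex.Im (E i j)|).

Lemma nsqc_ge0 z : 0 <= nsqc z.
Proof. by rewrite addr_ge0 ?sqr_ge0. Qed.

Lemma nsqc_le_nsq p (v : 'rV[R[i]]_p) i : nsqc (v 0 i) <= nsq v.
Proof.
rewrite /nsq (bigD1 i)//= lerDl sumr_ge0// => j _; exact: nsqc_ge0.
Qed.

Lemma nsq_gt0 p (v : 'rV[R[i]]_p) : v != 0 -> 0 < nsq v.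
Proof.
move=> v0; have [i vi0] : exists i, v 0 i != 0.
  apply/existsP; apply: contraNT v0; rewrite negb_exists => /forallP v0.
  by apply/eqP/rowP => i; rewrite mxE; apply/eqP; move: (v0 i); rewrite negbK.
apply: lt_le_trans (nsqc_le_nsq v i); rewrite lt_neqAle nsqc_ge0 andbT eq_sym.
apply: contra vi0; rewrite /nsqc paddr_eq0 ?sqr_ge0// !sqrf_eq0.
by case: (v 0 i) => a b /= /andP[/eqP-> /eqP->].
Qed.

Lemma quadD p (H E : 'M[R[i]]_p) v : quad (H + E) v = quad H v + quad E v.
Proof.
rewrite /quad mulmxDr mulmxDl mxE.
by case: (_ 0 0) => a b; case: (_ 0 0).
Qed.

Lemma Re_mulconj (a : R) (z : R[i]) :
  complex.Re (z * a%:C * z^*%R) = a * nsqc z.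
Proof. by rewrite /nsqc; case: z => x y /=; ring. Qed.

Lemma Re_sum (I : Type) (s : seq I) (P : pred I) (F : I -> R[i]) :
  complex.Re (\sum_(i <- s | P i) F i) = \sum_(i <- s | P i) complex.Re (F i).
Proof.
elim/big_rec2: _ => // i y z _ <-.
by case: (F i) z => a b [].
Qed.

Lemma quad_diag p (d : 'I_p -> R) (v : 'rV[R[i]]_p) :
  quad (diag_mx (\row_j (d j)%:C)) v = \sum_j d j * nsqc (v 0 j).
Proof.
rewrite /quad mxE Re_sum; apply: eq_bigr => j _.
by rewrite mul_mx_diag !mxE Re_mulconj.
Qed.

Lemma quad_congr p (P D : 'M[R[i]]_p) v :
  quad (P ^t* *m D *m P) v = quad D (v *m P ^t* ).
Proof.
rewrite /quad; congr (complex.Re (_ 0 0)).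
by rewrite trmx_mul map_mxM trmxCK !mulmxA.
Qed.

Lemma quad_eigen p (H : 'M[R[i]]_p) v (a : R) :
  v *m H = a%:C *: v -> quad H v = a * nsq v.
Proof.
move=> vH; rewrite /quad vH -scalemxAl !mxE mulr_sumr Re_sum mulr_sumr.
apply: eq_bigr => j _; rewrite !mxE.
by rewrite -Re_mulconj// mulrA [_%:C * _]mulrC.
Qed.

Lemma quad1 p v : quad (1%:M : 'M[R[i]]_p) v = nsq v.
Proof. by rewrite (@quad_eigen _ _ _ 1) ?mul1r// mulmx1 scale1r. Qed.

Lemma quad_le_l1norm p (E : 'M[R[i]]_p) v : quad E v <= l1norm E * nsq v.
Proof.
rewrite /quad mxE Re_sum /l1norm exchange_big/= mulr_suml.
apply: ler_sum => j _; rewrite !mxE.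
rewrite !mulr_suml Re_sum; apply: ler_sum => i _.
have := nsqc_le_nsq v i; have := nsqc_le_nsq v j; rewrite /nsqc.
move: (nsq v) => N; case: (v 0 i) (v 0 j) (E i j) => a b [a' b'] [e f] /=.
move=> vi vj.
pose s := a * a' + b * b'; pose t := b * a' - a * b'.
have amgm (x y z u : R) : x ^+ 2 + y ^+ 2 <= N -> z ^+ 2 + u ^+ 2 <= N ->
    `|x * z + y * u| <= N.
  move=> xyN zuN; rewrite ler_norml.
  have := sqr_ge0 (x - z); have := sqr_ge0 (x + z).
  have := sqr_ge0 (y - u); have := sqr_ge0 (y + u).
  rewrite !sqrrD !sqrrN => *; apply/andP; split; lra.
have sN : `|s| <= N by exact: amgm.
have tN : `|t| <= N by rewrite /t -mulrN; apply: amgm; rewrite ?sqrrN// addrC.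
apply: (@le_trans _ _ (`|e| * `|s| + `|f| * `|t|)); last first.
  by rewrite mulrDl lerD// ler_wpM2l.
apply: (@le_trans _ _ (e * s + - (f * t))).
  by rewrite le_eqVlt; apply/orP; left; apply/eqP; rewrite /s /t; ring.
apply: lerD; first by rewrite -normrM ler_norm.
by rewrite -normrM -normrN ler_norm.
Qed.

Lemma hermitian_diagonalization p (H : 'M[R[i]]_p) : H \is hermsymmx ->
  exists (d : 'I_p -> R) (P : 'M[R[i]]_p),
  P \is unitarymx /\ H = P ^t* *m diag_mx (\row_j (d j)%:C) *m P.
Proof.
move=> Hherm.
exists (fun j => complex.Re (spectral_diag H 0 j)), (spectralmx H).
split; first exact: spectral_unitarymx.
rewrite -invmx_unitary ?spectral_unitarymx//.
have /orthomx_spectralP HE := hermitian_normalmx Hherm.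
rewrite [LHS]HE; congr (_ *m _ *m _); congr diag_mx.
apply/rowP => j; rewrite mxE.
by rewrite RRe_real// (mxOverP (hermitian_spectral_diag_real Hherm)).
Qed.

Lemma char_poly_conj (F : fieldType) p (P D : 'M[F]_p) : P \in unitmx ->
  char_poly (invmx P *m D *m P) = char_poly D.
Proof.
move=> Pu; rewrite /char_poly.
have -> : char_poly_mx (invmx P *m D *m P) =
    map_mx polyC (invmx P) *m char_poly_mx D *m map_mx polyC P.
  rewrite /char_poly_mx mulmxBr mulmxBl !map_mxM/=; congr (_ - _).
  by rewrite mul_mx_scalar -scalemxAl -map_mxM mulVmx// map_mx1 scalemx1.
rewrite !det_mulmx mulrAC -det_mulmx -map_mxM mulVmx// map_mx1 det1 mul1r//.
Qed.

Lemma horner_char_poly (F : fieldType) p (A : 'M[F]_p) (a : F) :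
  (char_poly A).[a] = \det (a%:M - A).
Proof.
rewrite /char_poly -horner_evalE -det_map_mx; congr (\det _).
apply/matrixP => i j; rewrite !mxE /= horner_evalE.
by rewrite hornerD hornerN hornerC hornerMn hornerX.
Qed.

(** Both clauses are read off one unitary diagonalization, so that the list [d]
    of eigenvalues in Rayleigh's principle is, with multiplicities, the list of
    roots of the characteristic polynomial. *)
Lemma hermitian_spectrum p (H : 'M[R[i]]_p) : H \is hermsymmx ->
  exists d : 'I_p -> R,
    char_poly H = \prod_i ('X - ((d i)%:C)%:P) /\
    (forall (a : R) (v : 'rV_p), (forall i, a <= d i) -> a * nsq v <= quad H v).
Proof.
move=> /hermitian_diagonalization[d [P [Pu HE]]]; exists d; split.
  rewrite HE -invmx_unitary// char_poly_conj ?unitarymx_unit//.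
  rewrite char_poly_trig ?diag_mx_is_trig//; apply: eq_bigr => i _.
  by rewrite !mxE eqxx.
move=> a v ad; rewrite HE quad_congr quad_diag.
have -> : nsq v = nsq (v *m P ^t* ).
  rewrite -!quad1 -quad_congr mulmx1; congr (quad _ v).
  by rewrite -invmx_unitary// mulVmx// unitarymx_unit.
rewrite /nsq mulr_sumr ler_sum// => i _; rewrite ler_wpM2r ?nsqc_ge0//.
Qed.

Lemma lambda_minE p (H : 'M[R[i]]_p) (d : 'I_p -> R) : (0 < p)%N ->
  char_poly H = \prod_i ('X - ((d i)%:C)%:P) ->
  exists i0, lambda_min H = d i0 /\ forall i, d i0 <= d i.
Proof.
case: p H d => // p H d _ Hd.
have [i0 _ d_min] := @arg_minP _ _ _ ord0 xpredT d isT.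
exists i0; split=> [|i]; last exact: d_min.
have eigE r : eigenvalue H r%:C <-> exists i, r = d i.
  rewrite eigenvalue_root_char Hd rootE horner_prod; split.
    move=> /prodf_eq0[i _]; rewrite hornerXsubC subr_eq0 => /eqP/complexI ->.
    by exists i.
  by move=> [i ->]; rewrite (bigD1 i)//= hornerXsubC subrr mul0r.
rewrite /lambda_min; apply/le_anti/andP; split.
  apply: ge_inf; last by apply/eigE; exists i0.
  by exists (d i0) => r /eigE[i ->]; exact: d_min.
apply: lb_le_inf; first by exists (d i0); apply/eigE; exists i0.
by move=> r /eigE[i ->]; exact: d_min.
Qed.

Lemma lambda_min_rayleigh p (H : 'M[R[i]]_p) v : (0 < p)%N ->
  H \is hermsymmx -> lambda_min H * nsq v <= quad H v.
Proof.
move=> p0 /hermitian_spectrum[d [Hd Hquad]].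
by have [i0 [-> dmin]] := lambda_minE p0 Hd; exact: Hquad.
Qed.

Lemma lambda_min_eigenvalue p (H : 'M[R[i]]_p) : (0 < p)%N ->
  H \is hermsymmx -> eigenvalue H (lambda_min H)%:C.
Proof.
move=> p0 /hermitian_spectrum[d [Hd Hquad]].
have [i0 [-> _]] := lambda_minE p0 Hd.
by rewrite eigenvalue_root_char Hd rootE horner_prod (bigD1 i0)//=
  hornerXsubC subrr mul0r.
Qed.

(** Weyl's perturbation bound: test the quadratic form of K on an eigenvector
    of H for its least eigenvalue. *)
Lemma lambda_min_lipschitz p (H K : 'M[R[i]]_p) : (0 < p)%N ->
  H \is hermsymmx -> K \is hermsymmx ->
  lambda_min K <= lambda_min H + l1norm (K - H).
Proof.
move=> p0 Hh Kh.
have /eigenvalueP[v vH v0] := lambda_min_eigenvalue p0 Hh.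
have nv := nsq_gt0 v0.
have qv := quad_eigen vH.
suff : lambda_min K * nsq v <= (lambda_min H + l1norm (K - H)) * nsq v.
  by rewrite ler_pM2r.
rewrite mulrDl -[X in _ <= X + _]qv.
apply: le_trans (lambda_min_rayleigh v p0 Kh) _.
have -> : quad K v = quad H v + quad (K - H) v by rewrite -quadD addrC subrK.
by rewrite lerD2l quad_le_l1norm.
Qed.

(** On the real line the characteristic polynomial of a Hermitian matrix is a
    real polynomial, since its roots are real; so taking real parts of the
    determinant loses nothing, and in particular keeps the derivative nonzero at
    a simple root. *)
Lemma hermitian_char_poly_real p (H : 'M[R[i]]_p) (a : R) : H \is hermsymmx ->
  simple_eigenvalue H a%:C ->
  exists q : {poly R}, q^`().[a] != 0 /\
    forall l : R, complex.Re (\det ((l%:C)%:M - H)) = q.[l].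
Proof.
move=> /hermitian_spectrum[d [Hd _]]; rewrite /simple_eigenvalue Hd => mup1.
exists (\prod_i ('X - (d i)%:P)); split; last first.
  move=> l; rewrite -horner_char_poly Hd !horner_prod.
  have -> : \prod_i ('X - ((d i)%:C)%:P).[l%:C] = (\prod_i (l - d i))%:C.
    rewrite rmorph_prod; apply: eq_bigr => i _.
    by rewrite hornerXsubC /= rmorphB.
  by rewrite /=; apply: eq_bigr => i _; rewrite hornerXsubC.
have prod0 (I : finType) (P : pred I) (c : I -> R[i]) :
    \prod_(i | P i) ('X - (c i)%:P) != 0.
  by apply/prodf_neq0 => i _; rewrite polyXsubC_eq0.
have [i0 di0] : exists i, d i = a.
  apply: contrapT => dN; move: mup1; rewrite mupNroot// rootE horner_prod.
  apply/prodf_neq0 => i _; rewrite hornerXsubC subr_eq0.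
  by apply: contra_notN dN => /eqP/complexI ->; exists i.
have dN j : j != i0 -> d j != a.
  move=> ji0; apply: contra_eq_neq mup1 => dj.
  rewrite neq_ltn; apply/orP; right.
  rewrite ltnNge mup_leq ?prod0// negbK.
  by rewrite (bigD1 i0)//= (bigD1 j)//= di0 dj mulrA -expr2 dvdp_mulr.
rewrite (bigD1 i0)//= di0 derivM derivXsubC hornerD !hornerM.
rewrite hornerXsubC subrr mul0r addr0 hornerC mul1r horner_prod.
by apply/prodf_neq0 => i /dN; rewrite hornerXsubC subr_eq0 eq_sym.
Qed.

End Rayleigh.

(** * Partial derivatives on a product *)

Section PartialDerivatives.
Variables (R : realType) (V : normedModType R).
Implicit Types (F : V * R -> R).

Let line_snd x (t h : R) :
  h *: (0, 1) + (x, t) = (x, h *: 1 + t) :> V * R.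
Proof. by congr pair; rewrite /= scaler0 add0r. Qed.

Let line_fst (x u : V) (t h : R) :
  h *: (u, 0) + (x, t) = (h *: u + x, t) :> V * R.
Proof. by congr pair; rewrite /= scaler0 add0r. Qed.

Lemma derive_snd F x (t : R) :
  'D_(0, 1) F (x, t) = 'D_1 (fun s => F (x, s)) t.
Proof.
rewrite /derive; set f := (X in lim (X @ _) = _).
set g := (X in _ = lim (X @ _)); suff -> : f = g by [].
by apply/funext => h; rewrite /f /g /= line_snd.
Qed.

Lemma derivable_snd F x (t : R) :
  derivable F (x, t) (0, 1) -> derivable (fun s => F (x, s)) t 1.
Proof.
rewrite /derivable; set f := (X in cvg (X @ _) -> _).
set g := (X in _ -> cvg (X @ _)).
suff -> : f = g by [].
by apply/funext => h; rewrite /f /g /= line_snd.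
Qed.

Lemma derive_fst F (x u : V) (t : R) :
  'D_(u, 0) F (x, t) = 'D_u (fun y => F (y, t)) x.
Proof.
rewrite /derive; set f := (X in lim (X @ _) = _).
set g := (X in _ = lim (X @ _)); suff -> : f = g by [].
by apply/funext => h; rewrite /f /g /= line_fst.
Qed.

Lemma derivable_fst F (x u : V) (t : R) :
  derivable F (x, t) (u, 0) -> derivable (fun y => F (y, t)) x u.
Proof.
rewrite /derivable; set f := (X in cvg (X @ _) -> _).
set g := (X in _ -> cvg (X @ _)).
suff -> : f = g by [].
by apply/funext => h; rewrite /f /g /= line_fst.
Qed.

Lemma Ck_fst k (W : set (V * R)) (f : V -> R) (U : set V) :
  open W -> (forall p, W p -> U p.1) -> Ck k U f -> Ck k W (fun p => f p.1).
Proof.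
move=> oW WU; elim: k f => [|k IHk] f /=.
  move=> fc p Wp; apply: continuous_comp; last exact/fc/WU.
  by case: p {Wp} => a b; exact: cvg_fst.
move=> [df Df]; have dfst (p : V * R) : differentiable fst p.
  apply: linear_differentiable => -[a b]; exact: cvg_fst.
have dfp p : W p -> differentiable (f \o fst) p.
  by move=> /WU/df dfp; exact: differentiable_comp.
split=> // u; apply: (Ck_eq oW) (IHk _ (Df u.1)) => p Wp.
rewrite (deriveE u (dfp p Wp)) diff_comp//=; last by exact/df/WU.
rewrite diff_lin; last by case=> a b; exact: cvg_fst.
by rewrite deriveE//; exact/df/WU.
Qed.

Lemma Ck_snd k (W : set (V * R)) : open W -> Ck k W (fun p => p.2).
Proof.
move=> oW; apply: (@Ck_linear _ _ _ oW k (snd : {linear (V * R)%type -> R})).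
by case=> a b; exact: cvg_snd.
Qed.

Lemma Ck_neighborhood k (U : set V) (f : V -> R) x : open U -> U x ->
  Ck k U f -> f x != 0 ->
  exists U' : set V,
    [/\ open U', U' x, U' `<=` U & forall y, U' y -> f y != 0].
Proof.
move=> oU Ux fk fx0.
have fxc := Ck_continuous fk Ux.
exists (U `&` [set y | f y != 0])°%classic; split.
- exact: open_interior.
- apply: filterI; first by apply: open_nbhs_nbhs.
  have : \forall z \near f x, z != 0.
    by apply: open_nbhs_nbhs; split => //; exact: open_neq.
  exact: fxc.
- by move=> y /interior_subset[].
- by move=> y /interior_subset[].
Qed.

Lemma Ck2_C2_at (U : set V) (f : V -> R) x : open U -> U x -> Ck 2 U f ->
  C2_at f x.
Proof.
move=> oU Ux [df Df].
have : \forall y \near x, U y by apply: open_nbhs_nbhs.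
apply: filterS => y Uy; split.
- exact: df.
- by move=> u; have [dDf _] := Df u; exact: dDf.
- by move=> u v; have [_ DDf] := Df u; exact: DDf.
Qed.

End PartialDerivatives.

Lemma Ck_proj1 (R : realType) k (U : set (R * R)) : open U ->
  Ck k U (fun q : R * R => q.1).
Proof.
move=> oU; apply: (@Ck_linear _ _ _ oU k (fst : {linear (R * R)%type -> R})).
by case=> a b; exact: cvg_fst.
Qed.

(** * The Hermitian matrix function of a shifted system *)

Section System.
Variables (R : realType) (n m : nat) (M : lti R n m).

Lemma invmx_adj p (F : 'M[R[i]]_p) : (invmx F) ^t* = invmx (F ^t* ).
Proof. by rewrite trmx_inv map_invmx. Qed.

Lemma adjmxD p q (F G : 'M[R[i]]_(p, q)) : (F + G) ^t* = F ^t* + G ^t*.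
Proof. by rewrite linearD map_mxD. Qed.

Lemma spectral_abscissa_ub (l : R[i]) : eigenvalue (stA M) l ->
  complex.Re l <= spectral_abscissa (stA M).
Proof.
move=> Al; apply: ub_le_sup; last by exists l.
have [r rE] := closed_field_poly_normal (char_poly (stA M)).
exists (\sum_(z <- r) `|complex.Re z|) => _ [z /= Az <-].
have zr : z \in r.
  move: Az; rewrite eigenvalue_root_char rE (monicP (char_poly_monic _)).
  by rewrite scale1r root_prod_XsubC.
apply: le_trans (ler_norm _) _.
by rewrite (big_rem z)//= lerDl sumr_ge0.
Qed.

(** If iw were an eigenvalue of A + (xi/2) I then -xi/2 would be the real part
    of an eigenvalue of A, at most alpha(A), against xi < -2 alpha(A). *)
Lemma resolvent_unit xi w : xi < Xi_ub M ->
  (imag w)%:M - stA (shift M xi) \in unitmx.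
Proof.
move=> xiub; rewrite unitmxE unitfE -horner_char_poly; apply/negP.
rewrite -/(root _ _) -eigenvalue_root_char => /eigenvalueP[v vA v0].
have : eigenvalue (stA M) (imag w - (xi / 2)%:C).
  apply/eigenvalueP; exists v => //; move: vA; rewrite mulmxDr => vA.
  by rewrite scalerBl -vA mul_mx_scalar addrK.
move=> /spectral_abscissa_ub /=.
move: xiub; rewrite /Xi_ub lt_min => /andP[+ _].
lra.
Qed.

(** On the imaginary axis -s is the conjugate of s, which makes the first
    summand of Phi the adjoint of the second. *)
Lemma PhiE xi w : xi < Xi_ub M -> Phi (shift M xi) (imag w) =
  (transfer (shift M xi) (imag w)) ^t* + transfer (shift M xi) (imag w).
Proof.
move=> xiub; congr (_ + _); rewrite /transferH /transfer.
rewrite [RHS]adjmxD; congr (_ + _).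
rewrite !trmx_mul !map_mxM mulmxA; congr (_ *m _ *m _).
rewrite invmx_adj; congr invmx.
rewrite raddfB/= map_mxB tr_scalar_mx map_scalar_mx; congr (_%:M - _).
by apply/eqP; rewrite eq_complex /=; apply/andP; split; rewrite ?oppr0.
Qed.

Lemma Phi_hermitian xi w : xi < Xi_ub M ->
  Phi (shift M xi) (imag w) \is hermsymmx.
Proof.
move=> xiub; rewrite (PhiE w xiub); apply/is_hermitianmxP.
move: (transfer _ _) => T; rewrite expr0 scale1r [RHS]adjmxD.
by rewrite [(T ^t* ) ^t* ]trmxCK addrC.
Qed.

Lemma Ck_Phi (V : normedModType R) k (U : set V) (xi w : V -> R) : open U ->
  (forall x, U x -> xi x < Xi_ub M) -> Ck k U xi -> Ck k U w ->
  CkMx U k (fun x => Phi (shift M (xi x)) (imag (w x))).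
Proof.
move=> oU xiub xik wk.
have imagk : CkC U k (fun x => imag (w x)) by split => //; exact: Ck_cst.
have xi2k : CkMx U k (fun x => ((xi x / 2)%:C)%:M : 'M[R[i]]_n).
  apply: CkMx_scalar => //; apply: CkC_real => //; apply: CkM => //.
  exact: Ck_cst.
have xi2k' : CkMx U k (fun x => ((xi x / 2)%:C)%:M : 'M[R[i]]_m).
  apply: CkMx_scalar => //; apply: CkC_real => //; apply: CkM => //.
  exact: Ck_cst.
have Ak : CkMx U k (fun x => (imag (w x))%:M - stA (shift M (xi x))).
  apply: CkMxD => //; first exact: CkMx_scalar.
  by apply: CkMxN => //; apply: CkMxD => //; exact: CkMx_cst.
have Ik := CkMx_inv oU (fun x Ux => resolvent_unit (w x) (xiub x Ux)) Ak.
have Tk : CkMx U k (fun x => transfer (shift M (xi x)) (imag (w x))).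
  apply: CkMxD => //; last first.
    by apply: CkMxD => //; [exact: CkMx_cst|exact: CkMxN].
  apply: CkMxM => //; last exact: CkMx_cst.
  by apply: CkMxM => //; exact: CkMx_cst.
apply: (CkMx_eq oU) (CkMxD oU (CkMx_adj oU Tk) Tk) => x Ux.
by rewrite PhiE// xiub.
Qed.

(** Where the resolvent exists at every imaginary frequency. *)
Definition stable_domain : set (R * R) := [set p | p.1 < Xi_ub M].

Lemma open_stable_domain : open stable_domain.
Proof.
rewrite (_ : stable_domain = fst @^-1` [set x | x < Xi_ub M]%classic)//.
apply: open_comp; last exact: open_lt.
by move=> [a b] _; exact: cvg_fst.
Qed.

End System.

(** * Smoothness of gamma and of the path of stationary points *)

Section Smoothness.
Variables (R : realType) (n m : nat) (M : lti R n m).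
Local Notation gam := (fun p : R * R => gamma M p.1 p.2).
Local Notation PhiM p := (Phi (shift M p.1) (imag p.2)).

Lemma l1norm_sym p (H K : 'M[R[i]]_p) : l1norm (H - K) = l1norm (K - H).
Proof.
apply: eq_bigr => i _; apply: eq_bigr => j _; rewrite -opprB mxE.
by case: ((K - H) i j) => a b /=; rewrite !normrN.
Qed.

Lemma gamma_continuous p : (0 < m)%N -> stable_domain M p ->
  {for p, continuous gam}.
Proof.
move=> m0 Up; have oU := @open_stable_domain _ _ _ M.
have Phik := Ck_Phi oU (fun x Ux => Ux) (Ck_proj1 0 oU) (Ck_snd 0 oU).
have Ek := CkMxD oU Phik (CkMx_cst 0 oU (- PhiM p)).
have N0 : (fun q => l1norm (PhiM q - PhiM p)) @ p --> (0 : R).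
  have -> : (0 : R) = l1norm (PhiM p - PhiM p).
    rewrite /l1norm big1// => i _; rewrite big1// => j _.
    by rewrite subrr mxE /= normr0 addr0.
  apply: cvg_big => [|i _]; first exact: add_continuous.
  apply: cvg_big => [|j _]; first exact: add_continuous.
  have [rE jE] := Ek i j.
  apply: cvgD; apply: cvg_norm; [exact: rE|exact: jE].
apply/cvgrPdist_le => e e0.
have : \forall q \near p, stable_domain M q by apply: open_nbhs_nbhs.
move/cvgrPdist_le: N0 => /(_ _ e0); apply: filterS2 => q Nq Uq.
have Hp := Phi_hermitian p.2 Up; have Hq := Phi_hermitian q.2 Uq.
rewrite sub0r normrN in Nq; apply: le_trans (le_trans (ler_norm _) Nq).
have gq : gamma M q.1 q.2 <= gamma M p.1 p.2 + l1norm (PhiM q - PhiM p).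
  exact: (lambda_min_lipschitz m0 Hp Hq).
have gp : gamma M p.1 p.2 <= gamma M q.1 q.2 + l1norm (PhiM q - PhiM p).
  by rewrite l1norm_sym; exact: (lambda_min_lipschitz m0 Hq Hp).
rewrite -[X in `|X|]/(gamma M p.1 p.2 - gamma M q.1 q.2).
move: (gamma M p.1 p.2) (gamma M q.1 q.2) (l1norm _) gp gq => a b N gp gq.
by rewrite ler_norml; apply/andP; split; lra.
Qed.

(** gamma is a continuous root of the characteristic polynomial, and at a
    simple eigenvalue this polynomial has a nonzero derivative. *)
Lemma gamma_smooth p : (0 < m)%N -> stable_domain M p ->
  simple_eigenvalue (PhiM p) (gam p)%:C ->
  exists U : set (R * R), [/\ open U, U p & forall k, Ck k U gam].
Proof.
move=> m0 Up simple; have oU := @open_stable_domain _ _ _ M.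
pose W : set ((R * R) * R) := fst @^-1` stable_domain M.
have oW : open W.
  by apply: open_comp => // -[a b] _; exact: cvg_fst.
pose F (q : (R * R) * R) : R :=
  complex.Re (\det ((q.2%:C)%:M - PhiM q.1)).
have Fk k : Ck k W F.
  have xik : Ck k W (fun q => q.1.1).
    by apply: (Ck_fst oW) (Ck_proj1 k oU).
  have wk : Ck k W (fun q => q.1.2).
    by apply: (Ck_fst oW) (Ck_snd k oU).
  have lk : CkC W k (fun q => q.2%:C) by apply: CkC_real => //; exact: Ck_snd.
  have Pk := Ck_Phi oW (fun q Wq => Wq) xik wk.
  by have [] := CkC_det oW (CkMxD oW (CkMx_scalar oW lk) (CkMxN oW Pk)).
have F0 q : stable_domain M q -> F (q, gam q) = 0.
  move=> Uq; rewrite /F /= -horner_char_poly.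
  have /= := lambda_min_eigenvalue m0 (Phi_hermitian q.2 Uq).
  by rewrite eigenvalue_root_char => /rootP ->.
have DF0 : 'D_(0, 1) F (p, gam p) != 0.
  have [q [q0 qE]] := hermitian_char_poly_real (Phi_hermitian p.2 Up) simple.
  rewrite derive_snd (_ : (fun s => F (p, s)) = horner q); last first.
    by apply/funext => s; exact: qE.
  by rewrite derive_val.
have DFk : Ck 0 W ('D_(0, 1) F) by have [_] := Fk 1; exact.
have gc : Ck 0 (stable_domain M) gam by move=> q; exact: gamma_continuous.
have graphW q : stable_domain M q -> W (q, gam q) by [].
have DFg : Ck 0 (stable_domain M) (fun q => 'D_(0, 1) F (q, gam q)).
  exact: Ck_graph oU graphW DFk gc.
have [U [oU' U'p U'sub U'0]] := Ck_neighborhood oU Up DFg DF0.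
exists U; split=> // k; apply: (@CkS _ _ _ k).
apply: (Ck_implicit oU') (Fk k.+1) _ _ _.
- by move=> q /U'sub; exact: graphW.
- by move=> q /U'sub; exact: gc.
- by move=> q /U'sub; exact: F0.
- exact: U'0.
Qed.

(** wp is a continuous solution of (d/dw) gamma (xi, w) = 0, and the derivative
    of this equation in w is the second derivative of gamma in w. *)
Lemma stationary_path_smooth (U : set (R * R)) (I : set R) (wp : R -> R) xi :
  open U -> (forall k, Ck k U gam) -> stationary_path M I wp -> I xi ->
  U (xi, wp xi) -> 'D_1 (derive1 (gamma M xi)) (wp xi) != 0 -> C2_at wp xi.
Proof.
move=> oU gk [oI _ wpc wps] Ixi Uxi D0.
have wpcI x : I x -> {for x, continuous wp}.
  by move=> Ix; apply: wpc; rewrite inE.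
pose G := 'D_(0, 1) gam.
have Gk k : Ck k U G by have [_] := gk k.+1; exact.
have GE x : (fun w => G (x, w)) = derive1 (gamma M x).
  by apply/funext => w; rewrite derive1E /G derive_snd.
have DG0 : 'D_(0, 1) G (xi, wp xi) != 0 by rewrite derive_snd GE.
pose J := (I `&` [set x | U (x, wp x)])°%classic.
have JI x : J x -> I x by move=> /interior_subset[].
have JU x : J x -> U (x, wp x) by move=> /interior_subset[].
have oJ : open J by exact: open_interior.
have Jxi : J xi.
  apply: filterI; first by apply: open_nbhs_nbhs.
  have : \forall p \near (xi, wp xi), U p by apply: open_nbhs_nbhs.
  exact: (continuous_graph (wpcI _ Ixi)).
have DGk : Ck 0 U ('D_(0, 1) G) by have [_] := Gk 1; exact.
have wpJ : Ck 0 J wp by move=> x /JI/wpcI.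
have [K [oK Kxi KJ K0]] :=
  Ck_neighborhood oJ Jxi (Ck_graph oJ JU DGk wpJ) DG0.
apply: (Ck2_C2_at oK Kxi); apply: (Ck_implicit oK) (Gk 2) _ _ K0.
- by move=> x /KJ/JU.
- by move=> x /KJ; exact: wpJ.
- move=> x /KJ/JI/wps st; rewrite -[G _]/((fun w => G (x, w)) (wp x)) GE.
  by rewrite derive1E; exact: derive_val.
Qed.

End Smoothness.

(** * Quadratic convergence of root-finding along a stationary path *)

Section LocalEstimates.
Variable (R : realType).

Lemma differentiable_lipschitz_at (V : normedModType R) (f : V -> R) x :
  differentiable f x ->
  exists2 K : R, 0 < K & \forall y \near x, `|f y - f x| <= K * `|y - x|.
Proof.
move=> df; have dfc := diff_continuous df.
have [K0 K0_gt0 LK] := linear_lipschitz dfc.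
exists (1 + K0); first by rewrite addr_gt0.
have x0 : (fun y : V => y - x) @ x --> (0 : V).
  by rewrite -(subrr x); apply: cvgB; [exact: cvg_id|exact: cvg_cst].
have : \forall y \near x,
    `|f (y - x + x) - f x - 'd f x (y - x)| <= 1 * `|y - x|.
  exact: (x0 _ (diff_estimate df ltr01)).
apply: filterS => y; rewrite subrK mul1r => est.
rewrite -[X in `|X|](subrK ('d f x (y - x))) mulrDl mul1r.
by apply: le_trans (ler_normD _ _) _; rewrite lerD.
Qed.

(** The frequencies may approach their limit from both sides, so the mean value
    theorem is used in a form that does not order the endpoints. *)
Lemma MVT_dist (f : R -> R) (a b r : R) :
  (forall t, `|t - a| < r -> derivable f t 1) -> `|b - a| < r ->
  exists2 c, `|c - a| <= `|b - a| & f b - f a = 'D_1 f c * (b - a).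
Proof.
move=> df bar.
have fc t : `|t - a| < r -> {for t, continuous f}.
  by move=> /df/derivable1_diffP; exact: differentiable_continuous.
have itv_dist t : t \in `[Num.min a b, Num.max a b] -> `|t - a| <= `|b - a|.
  rewrite in_itv/= ge_min le_max => /andP[].
  rewrite ler_norml; have := ler_norm (b - a); have := ler_norm (a - b).
  rewrite -[`|a - b|]normrN opprB.
  by move=> ? ? /orP[]? /orP[]?; apply/andP; split; lra.
have dfs t : t \in `]Num.min a b, Num.max a b[ -> is_derive t 1 f ('D_1 f t).
  move=> tab; apply: derivableP; apply: df; apply: le_lt_trans bar.
  exact/itv_dist/subset_itv_oo_cc.
have fcs : {within `[Num.min a b, Num.max a b], continuous f}.
  apply/continuous_in_subspaceT => t; rewrite inE/= => /itv_dist tab.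
  exact/fc/le_lt_trans/bar.
have mm : Num.min a b <= Num.max a b by rewrite le_max ge_min lexx.
have [c cab fE] := MVT_segment mm dfs fcs.
exists c; first exact: itv_dist.
move: fE; case: (leP a b) => ab //.
by rewrite -[f a - f b]opprB -[a - b]opprB mulrN => /oppr_inj.
Qed.

(** As g vanishes at (x k.+1, wp (x k)) and at (xit, wt), its variation in the
    first variable from (xit, wp (x k)) to (x k.+1, wp (x k)) is opposite to its
    variation in the second from (xit, wt) to (xit, wp (x k)).  The former
    controls |x k.+1 - xit|, the rate being bounded away from 0; the latter
    is quadratic in wp (x k) - wt, as wt is stationary. *)
Lemma q_quadratic_root_on_path (g : R * R -> R) (wp : R -> R) (x : R^nat)
    (xit : R) (wt := wp xit) :
  C2_at g (xit, wt) -> differentiable wp xit -> g (xit, wt) = 0 ->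
  'D_(0, 1) g (xit, wt) = 0 -> 'D_(1, 0) g (xit, wt) != 0 ->
  x @ \oo --> xit ->
  (\forall k \near \oo, g (x k.+1, wp (x k)) = 0) ->
  q_quadratic x xit.
Proof.
move=> gC2 dwp g0 D20 D10 xc groot; split=> //.
have [_ dD _] := nbhs_singleton gC2.
have [K K0 D2K] := differentiable_lipschitz_at (dD (0, 1)).
have [L L0 wpL] := differentiable_lipschitz_at dwp.
pose c := `|'D_(1, 0) g (xit, wt)| / 2.
have c0 : 0 < c by rewrite divr_gt0 ?normr_gt0.
have D1c : \forall p \near (xit, wt), c < `|'D_(1, 0) g p|.
  have D1cont : 'D_(1, 0) g @ (xit, wt) --> 'D_(1, 0) g (xit, wt).
    exact: differentiable_continuous (dD (1, 0)).
  have := @cvgr_gt R _ (nbhs (xit, wt)) _ _ _ (cvg_norm D1cont); apply.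
  by rewrite /c gtr_pMr ?normr_gt0// invf_lt1// ltr1n.
have /nbhs_ballP[r /= r0 rP] : \forall p \near (xit, wt),
    [/\ differentiable g p, c < `|'D_(1, 0) g p| &
     `|'D_(0, 1) g p| <= K * `|p - (xit, wt)|].
  move: D2K; rewrite D20 => D2K.
  by apply: filterS3 gC2 D1c D2K => p [dg _ _] cp; rewrite subr0.
have box a b : `|a - xit| < r -> `|b - wt| < r -> ball (xit, wt) r (a, b).
  by move=> ar br; split; rewrite /= -ball_normE /= distrC.
exists (K * L ^+ 2 / c); first by rewrite divr_gt0// mulr_gt0// exprn_gt0.
have wpc := cvg_comp _ _ xc (differentiable_continuous dwp).
have xc1 : (fun k => x k.+1) @ \oo --> xit by rewrite cvg_shiftS.
have near1 : \forall k \near \oo, `|x k.+1 - xit| < r.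
  by move/cvgrPdist_lt: xc1 => /(_ _ r0); apply: filterS => k; rewrite distrC.
have nearw : \forall k \near \oo, `|wp (x k) - wt| < r.
  by move/cvgrPdist_lt: wpc => /(_ _ r0); apply: filterS => k; rewrite distrC.
have nearL : \forall k \near \oo, `|wp (x k) - wt| <= L * `|x k - xit|.
  exact: (xc _ wpL).
near=> k.
have x1r : `|x k.+1 - xit| < r by near: k.
have wr : `|wp (x k) - wt| < r by near: k.
have wL : `|wp (x k) - wt| <= L * `|x k - xit| by near: k.
have gk : g (x k.+1, wp (x k)) = 0 by near: k.
move: (x k) (x k.+1) x1r wr wL gk => y z zr wr wL gz.
have rr0 (a : R) : `|a - a| < r by rewrite subrr normr0.
have [t tz gE] : exists2 t, `|t - xit| <= `|z - xit| &
    g (z, wp y) - g (xit, wp y) = 'D_(1, 0) g (t, wp y) * (z - xit).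
  have [||t tz ->] := @MVT_dist (fun u => g (u, wp y)) xit z r => //.
    move=> t tr; apply: derivable_fst; apply: diff_derivable.
    by have [] := rP _ (box _ _ tr wr).
  by exists t; [exact: tz|rewrite derive_fst].
have [s sw gE2] : exists2 s, `|s - wt| <= `|wp y - wt| &
    g (xit, wp y) - g (xit, wt) = 'D_(0, 1) g (xit, s) * (wp y - wt).
  have [||t' tz' ->] := @MVT_dist (fun s => g (xit, s)) wt (wp y) r => //.
    move=> t' tr; apply: derivable_snd; apply: diff_derivable.
    by have [] := rP _ (box _ _ (rr0 xit) tr).
  by exists t'; [exact: tz'|rewrite derive_snd].
have [_ cD _] := rP _ (box _ _ (le_lt_trans tz zr) wr).
have [_ _ DK] := rP _ (box _ _ (rr0 xit) (le_lt_trans sw wr)).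
have ds : `|(xit, s) - (xit, wt)| = `|s - wt|.
  by rewrite prod_normE/= subrr normr0; apply/max_idPr.
rewrite mulrAC ler_pdivlMr//.
have e1 : `|z - xit| * c <= `|'D_(1, 0) g (t, wp y) * (z - xit)|.
  by rewrite normrM mulrC ler_wpM2r// ltW.
apply: le_trans e1 _; rewrite -gE gz sub0r normrN -[g (xit, _)]subr0 -g0 gE2.
rewrite normrM -mulrA -exprMn.
apply: (@le_trans _ _ (K * `|wp y - wt| * `|wp y - wt|)).
  rewrite ler_wpM2r//; apply: le_trans DK _.
  by rewrite ds ler_pM2l.
by rewrite -mulrA -expr2 ler_pM2l// lerXn2r// nnegrE mulr_ge0// ltW.
Unshelve. all: by end_near. Qed.

End LocalEstimates.

(** * The iterates of HEC *)

Section HEC.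
Variables (R : realType) (n m : nat) (M : lti R n m).
Variables (root opt : R -> R -> R) (xi0 w0 : R).
Hypothesis subr_exact : exact_subroutines M root opt.
Hypothesis input0 : hec_input M xi0 w0.
Local Notation state := (hec M root opt xi0 w0).
Local Notation xi_ := (hec_xi M root opt xi0 w0).
Local Notation w_ := (hec_w M root opt xi0 w0).

Lemma hecS k : state k.+1 = hec_step M root opt (state k).
Proof. exact: iterS. Qed.

(** Each expansion strictly decreases gamma from the value 0 left by the
    contraction, so the next contraction starts again from gamma < 0. *)
Lemma hec_invariant k :
  xi_ k <= xi0 /\ (is_running (state k) -> hec_input M (xi_ k) (w_ k)).
Proof.
elim: k => [|k [xi_le IHk]]; first by [].
move: xi_le IHk; rewrite /hec_xi /hec_w hecS.
case: (state k) => [x w|x w] /= x_le; last by [].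
move=> /(_ isT) inp; have [/andP[rlb rle] r0] := root_exact subr_exact inp.
have rx0 := le_trans rle x_le.
case: (asboolP (stationary (gamma M (root x w)) w)) => st.
  by split; [exact: rx0|discriminate].
split=> [|_]; [exact: rx0|rewrite /state_xi /state_w].
have [/andP[lbx xub] /andP[_ f0]] := inp.
have bnd : Xi_lb M <= root x w < Xi_ub M by rewrite rlb (le_lt_trans rle).
have [_ +] := opt_exact subr_exact bnd r0 st.
by rewrite r0 => neg; split=> //; rewrite neg.
Qed.

Lemma hec_step_root k : is_running (state k) ->
  gamma M (xi_ k.+1) (w_ k) = 0.
Proof.
move=> run; have [_ /(_ run) inp] := hec_invariant k.
have [_ r0] := root_exact subr_exact inp.
suff -> : xi_ k.+1 = root (xi_ k) (w_ k) by exact: r0.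
move: run; rewrite /hec_xi /hec_w hecS.
case: (state k) => [x w|x w] /=; last by discriminate.
by case: (asboolP (stationary _ _)).
Qed.

Lemma hec_returned_cst k x w : state k = Returned x w ->
  forall j, (k <= j)%N -> state j = Returned x w.
Proof.
move=> hk j /subnK <-; elim: (j - k)%N => [|i IHi]; first by rewrite add0n.
by rewrite addSn hecS IHi.
Qed.

(** A returned pair is kept, so termination is convergence in finitely many
    steps. *)
Lemma hec_cvg xit wt : hec_computes M root opt xi0 w0 xit wt ->
  xi_ @ \oo --> xit.
Proof.
case=> _ [[k hk]|[_ xic _]] //.
apply: cvg_near_cst; exists k => // j kj.
by rewrite /hec_xi (hec_returned_cst hk kj).
Qed.

Lemma hec_computes_lt_ub xit wt : hec_computes M root opt xi0 w0 xit wt ->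
  xit < Xi_ub M.
Proof.
move=> /hec_cvg xic; have [/andP[_ xi0ub] _] := input0.
apply: le_lt_trans xi0ub; apply: cvgr_to_le xic _.
by apply: nearW => k; have [] := hec_invariant k.
Qed.

End HEC.

Theorem theorem4p9 (R : realType) (n m : nat) (n_gt0 : (0 < n)%N)
  (m_gt0 : (0 < m)%N) (M : lti R n m)
  (M_minimal : minimal M) (M_passive : passive M)
  (tau w0 : R) (tau01 : 0 < tau < 1)
  (root opt : R -> R -> R) (subr_exact : exact_subroutines M root opt)
  (xi_s w_s xit wt : R)
  (run_called : hec_call M tau w0 root opt xi_s w_s)
  (run_result : hec_computes M root opt xi_s w_s xit wt)
  (result_pseudoroot : pseudoroot M xit wt)
  (I : set R) (wp : R -> R)
  (cond_i : stationary_path M I wp /\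
     \forall k \near \oo, I (hec_xi M root opt xi_s w_s k) /\
       hec_w M root opt xi_s w_s k = wp (hec_xi M root opt xi_s w_s k))
  (cond_ii : [/\ I xit, wt = wp xit
     & \forall w \near wt, gamma M xit wt <= gamma M xit w])
  (cond_iii : exists2 d : R,
     is_derive xit (1 : R) (fun xi => gamma M xi wt) d & d != 0) :
  (C2_at (fun p : R * R => gamma M p.1 p.2) (xit, wt) ->
   C2_at wp xit ->
   q_quadratic (hec_xi M root opt xi_s w_s) xit)
  /\
  (simple_eigenvalue (Phi (shift M xit) (imag wt)) (gamma M xit wt)%:C ->
   (exists2 d : R,
      is_derive wt (1 : R) (derive1 (gamma M xit)) d & d != 0) ->
   C2_at (fun p : R * R => gamma M p.1 p.2) (xit, wt) /\ C2_at wp xit).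
Proof.
have [input0 computed] := run_result.
have [path on_path] := cond_i; have [Ixit wtE _] := cond_ii.
have [gam0 gam_stat] := result_pseudoroot.
split=> [gC2 wpC2|simple [d gam2 d0]].
  have xic := hec_cvg run_result.
  have [[k hk]|[run _ _]] := computed.
    (* after a return both sides of the estimate are 0, whatever the constant *)
    split=> //; exists 1 => //; exists k => // j /= kj.
    rewrite /hec_xi (hec_returned_cst hk kj) (hec_returned_cst hk (leqW kj)).
    by rewrite subrr normr0 mul1r sqr_ge0.
  have [dwp _ _] := nbhs_singleton wpC2.
  rewrite wtE in gC2 gam0 gam_stat cond_iii.
  apply: (q_quadratic_root_on_path gC2 dwp) => //=.
  - by rewrite derive_snd; exact: derive_val.
  - by have [d gam1 d0] := cond_iii; rewrite derive_fst /= derive_val.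
  - apply: filterS on_path => k [_ <-] /=.
    exact: (hec_step_root subr_exact input0 (run k)).
have xit_ub := hec_computes_lt_ub subr_exact input0 run_result.
have [U [oU Uxi gk]] := @gamma_smooth _ _ _ M (xit, wt) m_gt0 xit_ub simple.
split; first exact: Ck2_C2_at oU Uxi (gk 2).
rewrite wtE in Uxi gam2.
apply: (stationary_path_smooth oU gk path Ixit Uxi).
by rewrite derive_val.
Qed.
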